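(* For every even integer $n\ge 10$, there exists a cubic (i.e., $3$-regular) homogeneously traceable nonhamiltonian graph of order $n$. Moreover, for every integer $p\ge 18$, there exists a $4$-regular homogeneously traceable graph of order $p$ and circumference $p-4$.
   Context: All graphs are finite and simple. The order of a graph is its number of vertices. A graph $G$ is homogeneously traceable if every vertex of $G$ is an endpoint of some Hamilton path of $G$. The circumference of a graph is the length of a longest cycle in it. A graph is nonhamiltonian if it has no Hamilton cycle. *)

(* Defs.v *)
From mathcomp Require Import all_boot.

Set Implicit Arguments.
Unset Strict Implicit.
Unset Printing Implicit Defensive.

Record sgraph := SGraph {
  vertex :> finType;
  adj : rel vertex;
  adj_sym : symmetric adj;
  adj_irrefl : irreflexive adj }.

Definition graph_order (G : sgraph) : nat := #|G|.

Definition degree (G : sgraph) (v : G) : nat := #|[set w | adj v w]|.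

Definition regular (k : nat) (G : sgraph) : Prop := forall v : G, degree v = k.

(* A path is given as its first vertex x and the sequence p of the later ones;
   its endpoints are x and last x p. *)
Definition hamilton_path (G : sgraph) (x : G) (p : seq G) : bool :=
  [&& path (@adj G) x p, uniq (x :: p) & [forall v, v \in x :: p]].

Definition homogeneously_traceable (G : sgraph) : Prop :=
  forall v : G, exists (x : G) (p : seq G),
    hamilton_path x p /\ (v = x \/ v = last x p).

(* The bound on the size rules out the empty sequence and the degenerate
   closed walk [:: x; y] along a single edge, which ucycle accepts. *)
Definition graph_cycle (G : sgraph) (c : seq G) : Prop :=
  2 < size c /\ ucycle (@adj G) c.

Definition hamilton_cycle (G : sgraph) (c : seq G) : Prop :=
  graph_cycle c /\ forall v : G, v \in c.

Definition nonhamiltonian (G : sgraph) : Prop :=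
  ~ exists c : seq G, hamilton_cycle c.

Definition has_circumference (G : sgraph) (k : nat) : Prop :=
  (exists c : seq G, graph_cycle c /\ size c = k) /\
  (forall c : seq G, graph_cycle c -> size c <= k).

(* Main.v *)
Require Import Defs.
From mathcomp Require Import all_boot zify.

(* Cubic case: replace a vertex of the Petersen graph by a ladder with k rungs
   whose two rails meet in an apex (k = 0 gives the Petersen graph back). A
   Hamilton cycle of a cubic graph of even order yields a proper 3-edge-colouring;
   along the ladder such a colouring can only swap the colours of the two rails,
   so it induces a 3-edge-colouring of the Petersen graph, and there is none.

   Quartic case: take three branches, each the square of a path plus one edge, of
   which two have six vertices, and join the three first vertices in a triangle
   and likewise the three last ones. A cycle meeting the interiors of all three
   branches would cross each of them from end to end, i.e. cross between the two
   triangles three times, which is odd. So it misses one interior, hence at least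
   four vertices. *)

Set Implicit Arguments.
Unset Strict Implicit.
Unset Printing Implicit Defensive.

(** * Graphs given by neighbour lists *)

(** Lists over an arbitrary [eqType] keep the vertices concrete, so adjacency can be computed; they
    are packed into a finite type only when the graph itself is built. *)
Definition regular_nbrs (T : eqType) (d : nat) (s : seq T) (g : T -> seq T) :=
  uniq s /\
  {in s, forall x, [/\ size (g x) = d, uniq (g x), {subset g x <= s},
                       x \notin g x & {in g x, forall y, x \in g y}]}.

Lemma regular_nbrs_sym (T : eqType) d (s : seq T) g :
  regular_nbrs d s g -> {in s &, symmetric (grel g)}.
Proof.
case=> _ gs x y /gs[_ _ _ _ gx] /gs[_ _ _ _ gy] /=.
by apply/idP/idP => [/gx | /gy].
Qed.

Lemma regular_nbrs_graph (T : choiceType) d (s : seq T) g :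
    regular_nbrs d s g ->
  exists (G : sgraph) (f : G -> T),
    [/\ injective f, codom f =i s, {mono f : x y / adj x y >-> grel g x y},
        graph_order G = size s & regular d G].
Proof.
move=> gs; have sym := regular_nbrs_sym gs; case: gs => us gs.
have symG : symmetric (relpre (@ssval _ s) (grel g)).
  by move=> x y; apply: sym; apply: ssvalP.
have irrG : irreflexive (relpre (@ssval _ s) (grel g)).
  by move=> x /=; apply/negbTE; have [] := gs _ (ssvalP x).
exists (SGraph symG irrG), (@ssval _ s); split=> //=.
- exact: val_inj.
- move=> x; apply/codomP/idP => [[y ->]|xs]; first exact: ssvalP.
  by exists (SeqSub xs).
- by rewrite /graph_order /= card_seq_sub.
move=> v; have [<- ug sg _ _] := gs _ (ssvalP v).
rewrite /degree cardsE cardE -(size_map (@ssval _ s)).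
apply/perm_size/uniq_perm => //.
  by rewrite map_inj_uniq ?enum_uniq //; apply: val_inj.
move=> x; apply/mapP/idP => [[y]|xg]; first by rewrite mem_enum => yg ->.
by exists (SeqSub (sg _ xg)); rewrite ?mem_enum.
Qed.

Lemma lift_seq (T : eqType) (V : finType) (f : V -> T) (q : seq T) :
  {subset q <= codom f} -> exists p, map f p = q.
Proof.
elim: q => [|y q IHq] sq; first by exists [::].
have /codomP[x ->] := sq y (mem_head _ _).
by have [|p <-] := IHq; [move=> z zq; apply/sq/mem_behead | exists (x :: p)].
Qed.

(** One permutation condition stands for both distinctness and coverage, so paths glued from pieces
    can be checked by counting. *)
Definition hamilton_seq (T : eqType) (s : seq T) (e : rel T) x p :=
  path e x p && perm_eq (x :: p) s.

Lemma hamilton_seq_traceable (T : eqType) (s : seq T) e (G : sgraph)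
    (f : G -> T) :
    injective f -> codom f =i s -> {mono f : x y / adj x y >-> e x y} ->
    uniq s ->
    {in s, forall v, exists x p, hamilton_seq s e x p /\ (v = x \/ v = last x p)} ->
  homogeneously_traceable G.
Proof.
move=> f_inj fs fe us ham v.
have fvs : f v \in s by rewrite -fs codom_f.
have [x [p [/andP[pxp xps] vxp]]] := ham _ fvs.
have [|[|y q] // Eq] := @lift_seq _ _ f (x :: p).
  by move=> z zxp; rewrite fs -(perm_mem xps).
have [Ex Ep] := Eq.
exists y, q; split; last first.
  by rewrite -Ex -Ep last_map in vxp; case: vxp => /f_inj; [left | right].
apply/and3P; split.
- by move: pxp; rewrite -Ex -Ep path_map (eq_path fe).
- by rewrite -(map_inj_uniq f_inj) Eq (perm_uniq xps).
by apply/forallP=> z; rewrite -(mem_map f_inj) Eq (perm_mem xps) -fs codom_f.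
Qed.

Lemma map_graph_cycle (T : eqType) e (G : sgraph) (f : G -> T) c :
    injective f -> {mono f : x y / adj x y >-> e x y} ->
  graph_cycle c <-> 2 < size (map f c) /\ ucycle e (map f c).
Proof.
move=> f_inj fe; rewrite /graph_cycle /ucycle size_map map_inj_uniq // cycle_map.
by rewrite (eq_cycle fe).
Qed.

(** * Walking along a cycle *)

Lemma next_closed (T : eqType) (c : seq T) (W : pred T) x :
    uniq c -> x \in c -> W x -> {in c, forall y, W y -> W (next c y)} ->
  {in c, forall y, W y}.
Proof.
move=> uc xc Wx Wc y yc.
have [i q Ec] := rot_to xc.
have := cycle_next uc; rewrite -(rot_cycle i) Ec /= rcons_path => /andP[xq _].
(* Rotated to start at [x], the cycle is a path for the relation by which [W] passes to the next
   entry. That relation is transitive, so [x] hands [W] on to every entry. *)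
have {xq} : path [rel a b | W a ==> W b] x q.
  apply: (sub_in_path (P := mem c)) xq.
    by move=> a b ac _ /eqP <-; apply/implyP/Wc.
  by rewrite -Ec; apply/allP => a; rewrite mem_rot.
have W_trans : transitive [rel a b | W a ==> W b].
  by move=> b a d /= /implyP ab /implyP bd; apply/implyP => /ab.
move/(order_path_min W_trans)/allP => Wq.
move: yc; rewrite -(mem_rot i) Ec inE => /orP[/eqP -> // | /Wq /implyP].
exact.
Qed.

(** If the two agreed, [x] and its successor would be closed under [next] and make up all of [c]. *)
Lemma next_neq_prev (T : eqType) (c : seq T) x :
  uniq c -> x \in c -> 2 < size c -> next c x != prev c x.
Proof.
move=> uc xc c_gt2; apply/eqP => Enp.
have cxn: {in c, forall y, y \in [:: x; next c x]}.
  apply: (next_closed (x := x)) => //; first by rewrite mem_head.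
  move=> y yc; rewrite !inE => /orP[] /eqP->; rewrite ?eqxx ?orbT //.
  by rewrite Enp next_prev // eqxx.
by have := uniq_leq_size uc cxn; rewrite leqNgt c_gt2.
Qed.

Lemma odd_index_next (T : eqType) (c : seq T) x :
    uniq c -> ~~ odd (size c) -> x \in c ->
  odd (index (next c x) c) = ~~ odd (index x c).
Proof.
case: c => [|y c] // uc c_even xc; rewrite next_nth xc.
have := xc; rewrite -index_mem [size _]/= ltnS leq_eqVlt => /orP[/eqP Ex|lt_xc].
  (* Here [x] is the last entry: [nth] falls back to its default [y], the head, of index 0, while
     the index of [x] is odd because the size is even. *)
  by move: c_even; rewrite nth_default ?Ex //= eqxx negbK => ->.
rewrite -[nth y c _]/(nth y (y :: c) (index x (y :: c)).+1).
by rewrite index_uniq.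
Qed.

(* Along an even cycle the edges are coloured 0 and 1 alternately; all edges off
   the cycle get colour 2. *)
Lemma hamilton_edge_coloring (T : eqType) (s : seq T) g c :
    regular_nbrs 3 s g -> ucycle (grel g) c -> 2 < size c -> c =i s ->
    ~~ odd (size s) ->
  exists col : T -> T -> nat,
    [/\ forall x y, col x y < 3, {in s, forall x, {in g x, forall y, col x y = col y x}}
      & {in s, forall x, uniq (map (col x) (g x))}].
Proof.
case=> us gs /andP[gc uc] c_gt2 cs s_even.
have c_even: ~~ odd (size c) by rewrite (perm_size (uniq_perm uc us cs)).
pose n := next c; pose r x := odd (index x c).
have rn: {in c, forall x, r (n x) = ~~ r x} by move=> x; apply: odd_index_next.
have np: {in c, forall x, n x != prev c x} by move=> x xc; apply: next_neq_prev.
(* A cycle edge takes the parity of the index of its tail, in the direction of [next]. *)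
exists (fun x y => if n x == y then (r x : nat) else
                   if n y == x then (r y : nat) else 2); split.
- by move=> x y; do 2![case: ifP => _; first by case: (r _)].
- move=> x xs y _; case: eqP => [Ey|]; case: eqP => // Ex.
  have := np x; rewrite cs xs => /(_ isT); rewrite Ey -Ex prev_next ?eqxx //.
move=> x xs; have xc: x \in c by rewrite cs.
have [gx ug _ _ _] := gs _ xs; rewrite map_inj_in_uniq // => y z yg zg.
have nE w: n w = x -> w \in c -> w = prev c x by move=> <- wc; rewrite prev_next.
have [sg gy] : {subset g x <= c} /\ uniq (g x).
  by have [_ ? sg _ _] := gs _ xs; split=> // w /sg; rewrite cs.
have rp : r x = ~~ r (prev c x) by rewrite -rn ?mem_prev // /n next_prev.
have [yc zc] := (sg _ yg, sg _ zg).
case: (n x =P y) => [<-|nxy]; case: (n x =P z) => [<- //|nxz].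
- case: eqP => [/nE Ez | _]; last by case: (r x).
  by rewrite rp Ez //; case: (r _).
- case: eqP => [/nE Ey | _]; last by case: (r x).
  by rewrite rp Ey //; case: (r _).
case: (n y =P x) => [/nE Ey|nyx]; case: (n z =P x) => [/nE Ez|nzx].
- by rewrite Ey // Ez.
- by case: (r y).
- by case: (r z).
(* Both edges lie off the cycle. If [y] and [z] differed, they would form with the two cycle
   neighbours of [x] four distinct entries in a list of three. *)
move=> _; apply/eqP; apply: contraT => neq_yz.
have : uniq [:: n x; prev c x; y; z].
  rewrite /= !inE !negb_or np // neq_yz !andbT.
  have nyp w : n w <> x -> prev c x != w.
    by move=> nw; apply/eqP => Ew; apply: nw; rewrite -Ew /n next_prev.
  by rewrite !nyp // !andbT /=; apply/andP; split; apply/eqP.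
move/uniq_leq_size => /(_ (g x)); rewrite gx => sub4; apply: sub4 => w.
have [_ _ _ _ gsym] := gs _ xs.
rewrite !inE => /or4P[] /eqP -> //; first exact: (next_cycle gc).
have ps: prev c x \in s by rewrite -cs mem_prev.
have [_ _ _ _] := gs _ ps; apply; exact: (prev_cycle gc).
Qed.

(** * The cubic graphs *)

(** The vertex [inl (r, i)] is at level [i] of rail [r]; levels run from 0 to [k], and above them
    both rails end in the apex [inr 0]. *)
Definition ladder_above (k : nat) (r : bool) (i : nat) : bool * nat + nat :=
  if i == k then inr 0 else inl (r, i.+1).

(* The vertices of the Petersen graph other than its 9-cycle w_0 ... w_8 and the
   ladder are: inl (r, 0) is w_3 or w_6, inr 0 is the apex of the ladder, and
   inr 1, ..., inr 7 are w_0, w_1, w_2, w_4, w_5, w_7, w_8. *)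
Definition pnbrs (k : nat) (x : bool * nat + nat) : seq (bool * nat + nat) :=
  match x with
  | inl (r, 0) => ladder_above k r 0 ::
      (if r then [:: inr 5; inr 6] else [:: inr 3; inr 4])
  | inl (r, i.+1) => [:: ladder_above k r i.+1; inl (r, i); inl (~~ r, i.+1)]
  | inr j => nth [::]
      [:: [:: inl (false, k); inl (true, k); inr 1];
          [:: inr 0; inr 2; inr 7];
          [:: inr 1; inr 3; inr 5];
          [:: inr 2; inl (false, 0); inr 6];
          [:: inl (false, 0); inr 5; inr 7];
          [:: inr 4; inl (true, 0); inr 2];
          [:: inl (true, 0); inr 7; inr 3];
          [:: inr 6; inr 1; inr 4]] j
  end.

Fixpoint rungs (i n : nat) : seq (bool * nat + nat) :=
  if n is n'.+1 then inl (false, i) :: inl (true, i) :: rungs i.+1 n' else [::].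

Definition pverts (k : nat) := rungs 0 k.+1 ++ [seq inr j | j <- iota 0 8].

Lemma eq_inl (r r' : bool) (i j : nat) :
  (inl (r, i) == inl (r', j) :> bool * nat + nat) = (r == r') && (i == j).
Proof. by []. Qed.

Lemma mem_rungs_inl i n r j : (inl (r, j) \in rungs i n) = (i <= j < i + n).
Proof.
elim: n i => [|n IHn] i /=; first by rewrite in_nil; lia.
rewrite !inE IHn !eq_inl; case: (r) => /=; lia.
Qed.

Lemma mem_rungs_inr i n j : (inr j \in rungs i n) = false.
Proof. by elim: n i => //= n IHn i; rewrite !inE IHn. Qed.

Lemma uniq_rungs i n : uniq (rungs i n).
Proof. by elim: n i => //= n IHn i; rewrite inE !mem_rungs_inl IHn ltnn. Qed.

Lemma size_rungs i n : size (rungs i n) = n.*2.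
Proof. by elim: n i => //= n IHn i; rewrite IHn doubleS. Qed.

Lemma rungs_recr i n :
  rungs i n.+1 = rungs i n ++ [:: inl (false, i + n); inl (true, i + n)].
Proof.
elim: n i => [|n IHn] i; first by rewrite /= addn0.
by rewrite [LHS]/= -/(rungs i.+1 n.+1) IHn addSnnS.
Qed.

Lemma mem_pverts_inl k r i : (inl (r, i) \in pverts k) = (i <= k).
Proof.
rewrite mem_cat mem_rungs_inl; suff /negbTE->: inl (r, i) \notin map inr (iota 0 8).
  by rewrite orbF add0n ltnS.
by apply/mapP => -[].
Qed.

Lemma mem_pverts_inr k j : (inr j \in pverts k) = (j < 8).
Proof. by rewrite mem_cat mem_rungs_inr mem_map ?mem_iota // => ? ? []. Qed.

Lemma size_pverts k : size (pverts k) = k.*2 + 10.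
Proof. by rewrite size_cat size_rungs size_map size_iota doubleS; lia. Qed.

Lemma pnbrs_cubic k : regular_nbrs 3 (pverts k) (pnbrs k).
Proof.
split.
  rewrite cat_uniq uniq_rungs map_inj_uniq ?iota_uniq; last by move=> ? ? [].
  by rewrite andbT; apply/hasPn => x /mapP[j _ ->]; apply/negbT/mem_rungs_inr.
case=> [[r [|i]]|j].
- rewrite mem_pverts_inl => _; rewrite /= /ladder_above; split.
  + by case: r.
  + by case: ifP; case: r.
  + case: ifP; case: r => k0; apply/allP;
    rewrite /= ?mem_pverts_inl ?mem_pverts_inr //; lia.
  + by case: ifP; case: r.
  case: (0 =P k) => [<-|k0]; apply/allP; case: r => //=.
    by rewrite !inE eqxx !orbT.
    by rewrite !inE eqxx !orbT.
- rewrite mem_pverts_inl => ik; rewrite /= /ladder_above; split.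
  + by [].
  + by case: ifP; case: r; rewrite /= ?inE ?eq_inl //=; lia.
  + by case: ifP => Ek; apply/allP;
    rewrite /= ?mem_pverts_inl ?mem_pverts_inr //; lia.
  + by case: ifP; case: r; rewrite /= ?inE ?eq_inl //=; lia.
  have ltk: (i == k) = false by lia.
  apply/allP; rewrite /= !inE negbK eqxx !orbT andbT; apply/andP; split.
    by case: eqP => [->|_]; case: r; rewrite /= !inE ?eqxx ?orbT.
  by case: i {ik} ltk => [|i] ltk; rewrite /= /ladder_above ltk mem_head.
rewrite mem_pverts_inr.
case: j => [|[|[|[|[|[|[|[|j]]]]]]]] //= _; split=> //; apply/allP;
  rewrite /= ?mem_pverts_inl ?mem_pverts_inr //= /ladder_above;
  case: (k) => [|k'] /=; rewrite ?(inE, eqxx, orbT, leqnn) //.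
Qed.

(** Each two-digit name is the colour of the edge between the vertices of the 9-cycle with these
    indices; [a], [b], [c] colour the edges from the tenth vertex to w_3, w_6, w_0. *)
Lemma petersen_uncolorable a b c c23 c34 c56 c67 c01 c08 c12 c15 c27 c45 c48 c78 :
    all [in iota 0 3]
      [:: a; b; c; c23; c34; c56; c67; c01; c08; c12; c15; c27; c45; c48; c78] ->
  ~ all uniq
    [:: [:: a; b; c]; [:: c; c01; c08]; [:: c01; c12; c15]; [:: c12; c23; c27];
        [:: a; c23; c34]; [:: c34; c45; c48]; [:: c45; c56; c15]; [:: b; c56; c67];
        [:: c67; c78; c27]; [:: c78; c08; c48]].
Proof.
(* An exhaustive search by computation. Each vertex is tested as soon as its three edges have
   colours, which prunes the $3^{15}$ assignments. *)
have : all (fun a => all (fun b => all (fun c => uniq [:: a; b; c] ==>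
    all (fun c23 => all (fun c34 => uniq [:: a; c23; c34] ==>
    all (fun c56 => all (fun c67 => uniq [:: b; c56; c67] ==>
    all (fun c01 => all (fun c08 => uniq [:: c; c01; c08] ==>
    all (fun c12 => all (fun c15 => uniq [:: c01; c12; c15] ==>
    all (fun c27 => uniq [:: c12; c23; c27] ==>
    all (fun c45 => uniq [:: c45; c56; c15] ==>
    all (fun c48 => uniq [:: c34; c45; c48] ==>
    all (fun c78 => uniq [:: c67; c78; c27] ==> ~~ uniq [:: c78; c08; c48])
    (iota 0 3)) (iota 0 3)) (iota 0 3)) (iota 0 3)) (iota 0 3)) (iota 0 3))
    (iota 0 3)) (iota 0 3)) (iota 0 3)) (iota 0 3)) (iota 0 3)) (iota 0 3))
    (iota 0 3)) (iota 0 3)) (iota 0 3) by [].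
move=> H /and5P[a3 b3 c3 c233 /and5P[c343 c563 c673 c013]].
move=> /and5P[c083 c123 c153 c273 /and4P[c453 c483 c783 _]].
move=> /and5P[u0 u1 u2 u3 /and5P[u4 u5 u6 u7 /and3P[u8 u9 _]]].
move: H => /allP/(_ a a3)/allP/(_ b b3)/allP/(_ c c3)/implyP/(_ u0).
move=> /allP/(_ _ c233)/allP/(_ _ c343)/implyP/(_ u4).
move=> /allP/(_ _ c563)/allP/(_ _ c673)/implyP/(_ u7).
move=> /allP/(_ _ c013)/allP/(_ _ c083)/implyP/(_ u1).
move=> /allP/(_ _ c123)/allP/(_ _ c153)/implyP/(_ u2).
move=> /allP/(_ _ c273)/implyP/(_ u3)/allP/(_ _ c453)/implyP/(_ u6).
by move=> /allP/(_ _ c483)/implyP/(_ u5)/allP/(_ _ c783)/implyP/(_ u8); rewrite u9.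
Qed.

(* Going down one rung swaps the colours of the two rails, so the three edges
   leaving the ladder get three different colours. *)
Lemma pnbrs_uncolorable k (col : bool * nat + nat -> bool * nat + nat -> nat) :
    (forall x y, col x y < 3) ->
    {in pverts k, forall x, {in pnbrs k x, forall y, col x y = col y x}} ->
  ~ {in pverts k, forall x, uniq (map (col x) (pnbrs k x))}.
Proof.
move=> col3 colC colU.
pose a i := col (inl (false, i)) (ladder_above k false i).
pose b i := col (inl (true, i)) (ladder_above k true i).
pose c := col (inr 0) (inr 1).
have col_sym x y : x \in pverts k -> y \in pnbrs k x -> col x y = col y x.
  by move=> xk; apply: colC xk y.
have ladder n : n <= k -> uniq [:: a (k - n); b (k - n); c].
  elim: n => [|n IHn] n_lt.
    have := colU (inr 0); rewrite mem_pverts_inr => /(_ isT).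
    rewrite /= (col_sym _ (inl (false, k))) ?mem_pverts_inr ?(inE, eqxx, orbT) //.
    rewrite (col_sym _ (inl (true, k))) ?mem_pverts_inr ?(inE, eqxx, orbT) //.
    by rewrite subn0 /a /b /ladder_above eqxx.
  have [i Ei] : exists i, k - n = i.+1 by exists (k - n).-1; lia.
  have -> : k - n.+1 = i by lia.
  move: (IHn (ltnW n_lt)); rewrite Ei => IH.
  have ik : i < k by lia.
  have ia r : ladder_above k r i = inl (r, i.+1) by rewrite /ladder_above ltn_eqF.
  pose d := col (inl (false, i.+1)) (inl (true, i.+1)).
  have := colU (inl (false, i.+1)); rewrite mem_pverts_inl => /(_ ik).
  have := colU (inl (true, i.+1)); rewrite mem_pverts_inl => /(_ ik).
  rewrite [map _ _]/= [X in uniq X -> _]/= => ut uf.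
  have Ea : col (inl (false, i.+1)) (inl (false, i)) = a i.
    by rewrite col_sym ?mem_pverts_inl ?(inE, eqxx, orbT) // /a ia.
  have Eb : col (inl (true, i.+1)) (inl (true, i)) = b i.
    by rewrite col_sym ?mem_pverts_inl ?(inE, eqxx, orbT) // /b ia.
  have Ed : col (inl (true, i.+1)) (inl (false, i.+1)) = d.
    by rewrite col_sym ?mem_pverts_inl ?(inE, eqxx, orbT).
  (* The rung colour [d] avoids both rail colours above it, so it equals [c]; hence [a i] is
     [b i.+1] and [b i] is [a i.+1]. *)
  move: ut uf IH; rewrite /= -/(a i.+1) -/(b i.+1) Ea Eb Ed -/d !inE.
  have [ai bi] : a i < 3 /\ b i < 3 by rewrite /a /b.
  have [ai1 bi1] : a i.+1 < 3 /\ b i.+1 < 3 by rewrite /a /b.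
  have [c3 d3] : c < 3 /\ d < 3 by rewrite /c /d.
  lia.
have := ladder k (leqnn k); rewrite subnn => u0.
have inrU j : j < 8 -> uniq (map (col (inr j)) (pnbrs k (inr j))).
  by move=> j8; apply: colU; rewrite mem_pverts_inr.
have inlU r : uniq (map (col (inl (r, 0))) (pnbrs k (inl (r, 0)))).
  by apply: colU; rewrite mem_pverts_inl.
have inr_sym j x : j < 8 -> x \in pnbrs k (inr j) -> col (inr j) x = col x (inr j).
  by move=> j8; apply: col_sym; rewrite mem_pverts_inr.
apply: (@petersen_uncolorable (a 0) (b 0) c
  (col (inl (false, 0)) (inr 3)) (col (inl (false, 0)) (inr 4))
  (col (inl (true, 0)) (inr 5)) (col (inl (true, 0)) (inr 6))
  (col (inr 1) (inr 2)) (col (inr 1) (inr 7)) (col (inr 2) (inr 3))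
  (col (inr 2) (inr 5)) (col (inr 3) (inr 6)) (col (inr 4) (inr 5))
  (col (inr 4) (inr 7)) (col (inr 6) (inr 7))).
  by apply/allP => i; rewrite mem_iota !inE;
    do 14?[case/predU1P => [->|]]; try move/eqP ->; apply: col3.
apply/and5P; split; [by []| | | | apply/and5P; split; last (apply/and3P; split=> //)].
- by have := inrU 1 isT; rewrite [map _ _]/= (inr_sym 1 (inr 0)) // mem_head.
- by have := inrU 2 isT; rewrite [map _ _]/= (inr_sym 2 (inr 1)) // mem_head.
- have := inrU 3 isT; rewrite [map _ _]/= (inr_sym 3 (inr 2)) // ?mem_head //.
  by rewrite (inr_sym 3 (inl (false, 0))).
- exact: inlU false.
- by have := inrU 4 isT; rewrite [map _ _]/= (inr_sym 4 (inl (false, 0))).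
- have := inrU 5 isT; rewrite [map _ _]/= (inr_sym 5 (inr 4)) //.
  by rewrite (inr_sym 5 (inl (true, 0))) // (inr_sym 5 (inr 2)).
- exact: inlU true.
- have := inrU 6 isT; rewrite [map _ _]/= (inr_sym 6 (inl (true, 0))) //.
  by rewrite (inr_sym 6 (inr 3)).
have := inrU 7 isT; rewrite [map _ _]/= (inr_sym 7 (inr 6)) //.
by rewrite (inr_sym 7 (inr 1)) // (inr_sym 7 (inr 4)).
Qed.

Lemma pnbrs_nonhamiltonian k c :
  2 < size c -> ucycle (grel (pnbrs k)) c -> ~ c =i pverts k.
Proof.
move=> c_gt2 gc ck; have even_s: ~~ odd (size (pverts k)).
  by rewrite size_pverts oddD odd_double.
have [col [col3 colC colU]] :=
  hamilton_edge_coloring (pnbrs_cubic k) gc c_gt2 ck even_s.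
exact: pnbrs_uncolorable col3 colC colU.
Qed.

(** * Hamilton paths of the cubic graphs *)

Lemma rungs_cat i m n : rungs i (m + n) = rungs i m ++ rungs (i + m) n.
Proof.
elim: m i => [|m IHm] i; first by rewrite addn0.
by rewrite addSn /= IHm addSnnS.
Qed.

Lemma grel_above k r i : grel (pnbrs k) (inl (r, i)) (ladder_above k r i).
Proof. by case: i => [|i]; apply: mem_head. Qed.

(** A zigzag: the path crosses each rung before stepping down, so it changes rails [j] times. *)
Lemma ladder_descend k r j :
  exists p, [/\ path (grel (pnbrs k)) (inl (r, j)) p,
    perm_eq (inl (r, j) :: p) (inl (r (+) odd j, 0) :: rungs 1 j)
    & last (inl (r, j)) p = inl (r (+) odd j, 0)].
Proof.
elim: j r => [|j IHj] r; first by exists [::]; rewrite /= addbF.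
have [p [pp pj lp]] := IHj (~~ r).
have Er : r (+) odd j.+1 = ~~ r (+) odd j by rewrite addNb addbN.
exists (inl (~~ r, j.+1) :: inl (~~ r, j) :: p); rewrite Er; split=> //.
  by rewrite /= pp !(inE, eqxx, orbT).
apply/permP => P; have /permP/(_ P) := pj; rewrite rungs_recr /= count_cat /= => ->.
by rewrite add1n; case: r {IHj pp pj lp Er} => /=; lia.
Qed.

(** Up one rail, over the apex and down the other, using no rung. *)
Lemma ladder_cross k r i n : i + n = k ->
  exists p, [/\ path (grel (pnbrs k)) (inl (r, i)) p,
    perm_eq (inl (r, i) :: p) (inr 0 :: rungs i n.+1)
    & last (inl (r, i)) p = inl (~~ r, i)].
Proof.
elim: n i => [|n IHn] i Ek.
  rewrite addn0 in Ek; exists [:: inr 0; inl (~~ r, i)]; split=> //.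
    have := grel_above k r i; rewrite /ladder_above Ek eqxx /= => ->.
    by rewrite !inE; case: r; rewrite eqxx ?orbT.
  by apply/permP => P /=; case: r => /=; lia.
have [|p [pp pi lp]] := IHn i.+1; first by lia.
exists (inl (r, i.+1) :: rcons p (inl (~~ r, i))); split.
- rewrite /= rcons_path pp lp /= !(inE, eqxx, orbT) andbT.
  have := grel_above k r i; by rewrite /ladder_above ltn_eqF; [|lia].
- apply/permP => P; have /permP/(_ P) := pi.
  rewrite /= -cats1 count_cat /=; case: r {pp pi lp IHn} => /=; lia.
by rewrite /= last_rcons.
Qed.

(** The descent changes rails [k] times, so to end on rail [r] it must leave the apex along rail
    [r (+) odd k]. *)
Lemma ladder_start_apex k r :
  exists p, [/\ path (grel (pnbrs k)) (inr 0) p,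
    perm_eq (inr 0 :: p) [:: inr 0, inl (r, 0) & rungs 1 k]
    & last (inr 0) p = inl (r, 0)].
Proof.
have [p [pp pk lp]] := ladder_descend k (r (+) odd k) k.
rewrite addbK in pk lp; exists (inl (r (+) odd k, k) :: p); split=> //.
  by rewrite /= pp andbT; case: (_ (+) _); rewrite !(inE, eqxx, orbT).
by rewrite perm_cons.
Qed.

(** First around the part of the ladder above via the apex, back to the same level on the other
    rail, then one step down and a zigzag to the base. *)
Lemma ladder_start_rung k r i : i < k ->
  exists p r', [/\ path (grel (pnbrs k)) (inl (r, i.+1)) p,
    perm_eq (inl (r, i.+1) :: p) [:: inr 0, inl (r', 0) & rungs 1 k]
    & last (inl (r, i.+1)) p = inl (r', 0)].
Proof.
move=> ik; have [|p [pp pi lp]] := @ladder_cross k r i.+1 (k - i.+1); first by lia.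
have [q [qq qi lq]] := ladder_descend k (~~ r) i.
exists (p ++ inl (~~ r, i) :: q), (~~ r (+) odd i); split.
- by rewrite cat_path pp lp /= !(inE, eqxx, orbT).
- rewrite -cat_cons; have -> : k = i + (k - i.+1).+1 by lia.
  rewrite rungs_cat add1n; apply/permP => P.
  have /permP/(_ P) := pi; have /permP/(_ P) := qi.
  by rewrite !count_cat /= !count_cat => -> -> /=; lia.
by rewrite last_cat.
Qed.

(** Separates the part of a Hamilton path that depends on [k] from a tail through the eight
    remaining vertices, which can be listed explicitly. *)
Lemma pverts_extend k x p r q :
    path (grel (pnbrs k)) x p ->
    perm_eq (x :: p) [:: inr 0, inl (r, 0) & rungs 1 k] -> last x p = inl (r, 0) ->
    path (grel (pnbrs k)) (inl (r, 0)) q ->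
    perm_eq q (inl (~~ r, 0) :: [seq inr j | j <- iota 1 7]) ->
  hamilton_seq (pverts k) (grel (pnbrs k)) x (p ++ q) /\
  last x (p ++ q) = last (inl (r, 0)) q.
Proof.
move=> pp px lp qq qr; rewrite last_cat lp /hamilton_seq cat_path pp lp qq; split=> //=.
rewrite -cat_cons; apply/permP => P.
have /permP/(_ P) := px; have /permP/(_ P) := qr.
rewrite /pverts !count_cat => -> -> /=; case: r {pp px lp qq qr} => /=;
  by do ?[move: (nat_of_bool (P _)) => ?]; move: (count P _) => ?; lia.
Qed.

Lemma pnbrs_traceable k :
  {in pverts k, forall v, exists x p,
     hamilton_seq (pverts k) (grel (pnbrs k)) x p /\ (v = x \/ v = last x p)}.
Proof.
(* For the vertices [inr 2] to [inr 7], each of which is the far end of a path from the apex. *)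
have tails r q : path (grel (pnbrs k)) (inl (r, 0)) q ->
    perm_eq q (inl (~~ r, 0) :: [seq inr j | j <- iota 1 7]) ->
    exists x p, hamilton_seq (pverts k) (grel (pnbrs k)) x p /\
      (last (inl (r, 0)) q = x \/ last (inl (r, 0)) q = last x p).
  move=> qq qr; have [p [pp pk lp]] := ladder_start_apex k r.
  have [h <-] := pverts_extend pp pk lp qq qr.
  by exists (inr 0), (p ++ q); split; last right.
have tail r : exists2 q, path (grel (pnbrs k)) (inl (r, 0)) q &
    perm_eq q (inl (~~ r, 0) :: [seq inr j | j <- iota 1 7]).
  case: r; [exists [:: inr 5; inr 4; inl (false, 0); inr 3; inr 2; inr 1; inr 7; inr 6]
    | exists [:: inr 4; inr 5; inl (true, 0); inr 6; inr 7; inr 1; inr 2; inr 3]];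
    by rewrite //= !(inE, eqxx, orbT).
(* A path from the apex cannot end in [inr 1], since the edge between them would close a Hamilton
   cycle. Instead the whole ladder is crossed from one base vertex to the other, which serves the
   base vertices too. *)
have base r : exists q, hamilton_seq (pverts k) (grel (pnbrs k)) (inl (r, 0)) q /\
    last (inl (r, 0)) q = inr 1.
  have [p [pp pk lp]] := @ladder_cross k r 0 k erefl.
  pose q : seq (bool * nat + nat) :=
    if r then [:: inr 4; inr 5; inr 2; inr 3; inr 6; inr 7; inr 1]
    else [:: inr 5; inr 4; inr 7; inr 6; inr 3; inr 2; inr 1].
  exists (p ++ q); rewrite last_cat /q; split; last by case: r {pp pk lp q}.
  rewrite /hamilton_seq cat_path pp lp -cat_cons; apply/andP; split.
    by case: r {pp pk lp} q; rewrite /= !(inE, eqxx, orbT).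
  apply/permP => P; have /permP/(_ P) := pk; rewrite /pverts !count_cat => ->.
  by case: r {pp pk lp} q => /=;
    do ?[move: (nat_of_bool (P _)) => ?]; move: (count P _) => ?; lia.
case=> [[r [|i]]|j]; rewrite (mem_pverts_inl, mem_pverts_inr).
- by move=> _; have [q [h _]] := base r; exists (inl (r, 0)), q; split; last left.
- move=> /(ladder_start_rung r)[p [r' [pp pk lp]]]; have [q qq qr] := tail r'.
  have [h _] := pverts_extend pp pk lp qq qr.
  by exists (inl (r, i.+1)), (p ++ q); split; last left.
case: j => [|[|[|[|[|[|[|[|j]]]]]]]] // _.
- have [p [pp pk lp]] := ladder_start_apex k false; have [q qq qr] := tail false.
  have [h _] := pverts_extend pp pk lp qq qr.
  by exists (inr 0), (p ++ q); split; last left.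
- by have [q [h lq]] := base false; exists (inl (false, 0)), q; split; last right.
- by apply: (tails false
      [:: inr 3; inr 6; inl (true, 0); inr 5; inr 4; inr 7; inr 1; inr 2]);
    rewrite //= !(inE, eqxx, orbT).
- by apply: (tails false
      [:: inr 4; inr 5; inl (true, 0); inr 6; inr 7; inr 1; inr 2; inr 3]);
    rewrite //= !(inE, eqxx, orbT).
- by apply: (tails false
      [:: inr 3; inr 2; inr 1; inr 7; inr 6; inl (true, 0); inr 5; inr 4]);
    rewrite //= !(inE, eqxx, orbT).
- by apply: (tails true
      [:: inr 6; inr 7; inr 1; inr 2; inr 3; inl (false, 0); inr 4; inr 5]);
    rewrite //= !(inE, eqxx, orbT).
- by apply: (tails true
      [:: inr 5; inr 4; inl (false, 0); inr 3; inr 2; inr 1; inr 7; inr 6]);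
    rewrite //= !(inE, eqxx, orbT).
by apply: (tails true
      [:: inr 6; inr 3; inl (false, 0); inr 4; inr 5; inr 2; inr 1; inr 7]);
  rewrite //= !(inE, eqxx, orbT).
Qed.

(** * The quartic graphs *)

(** Six is the least length for which the second and the last but one vertices of a branch are not
    already within distance 2. Branch 2 alone absorbs the varying order. *)
Definition blen (m i : nat) : nat := if i == 2 then m else 6.

(* Vertex (i, a) is the a-th vertex of the i-th branch, 0 <= a < blen m i. Inside
   a branch, vertices at distance at most 2 are adjacent, and so are the second
   and the last but one; the three first vertices form a triangle, and so do the
   three last ones. *)
Definition bnbrs (m : nat) (x : nat * nat) : seq (nat * nat) :=
  let: (i, a) := x in
  let j := i.+1 %% 3 in
  let k := i.+2 %% 3 in
  if a == 0 then [:: (i, 1); (i, 2); (j, 0); (k, 0)]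
  else if a == 1 then [:: (i, 0); (i, 2); (i, 3); (i, blen m i - 2)]
  else if a.+1 == blen m i then
    [:: (i, a - 2); (i, a - 1); (j, (blen m j).-1); (k, (blen m k).-1)]
  else [:: (i, a - 2); (i, a - 1); (i, a.+1);
          if a.+2 == blen m i then (i, 1) else (i, a.+2)].

Arguments bnbrs : simpl never.

Definition bverts (m : nat) : seq (nat * nat) :=
  [seq (i, a) | i <- iota 0 3, a <- iota 0 (blen m i)].

Definition near (a b : nat) := [&& a != b, a <= b + 2 & b <= a + 2].

Lemma near_sym : symmetric near.
Proof. by move=> a b; rewrite /near eq_sym [_ && (_ <= _)]andbC. Qed.

Lemma mem_bverts m i a : ((i, a) \in bverts m) = (i < 3) && (a < blen m i).
Proof.
apply/allpairsPdep/andP => [[j [b []]]|[i3 ai]].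
  by rewrite !mem_iota => j3 bj [-> ->].
by exists i, a; rewrite !mem_iota.
Qed.

Lemma uniq_bverts m : uniq (bverts m).
Proof.
apply: allpairs_uniq_dep => [|i _|]; rewrite ?iota_uniq //.
by move=> [i a] [j b] _ _ /= [-> ->].
Qed.

Lemma size_bverts m : size (bverts m) = m + 12.
Proof. by rewrite size_allpairs_dep /= !size_iota /blen /=; lia. Qed.

Lemma blen_gt5 m i : 6 <= m -> 5 < blen m i.
Proof. by rewrite /blen; case: eqP. Qed.

(** Replaces the case distinction of [bnbrs] by a symmetric arithmetic condition, which [lia] can
    handle. *)
Lemma mem_bnbrs m i a j b : 6 <= m -> i < 3 -> a < blen m i ->
  ((j, b) \in bnbrs m (i, a)) =
  if j == i then
    (b < blen m i) &&
    [|| near a b, (a == 1) && (b.+2 == blen m i) | (b == 1) && (a.+2 == blen m i)]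
  else (j < 3) && ((a == 0) && (b == 0) || (a.+1 == blen m i) && (b.+1 == blen m j)).
Proof.
move=> m6 i3 ai; have li := blen_gt5 i m6; rewrite /bnbrs /near.
have : [/\ i.+1 %% 3 != i, i.+2 %% 3 != i, i.+1 %% 3 != i.+2 %% 3 &
  (j == i.+1 %% 3) || (j == i.+2 %% 3) = (j != i) && (j < 3)] by split; lia.
move: (i.+1 %% 3) (i.+2 %% 3) => j1 j2 [n1 n2 n12 Ej] /=.
have l1 := blen_gt5 j1 m6; have l2 := blen_gt5 j2 m6.
case: (j =P i) Ej => [->|ji] /= Ej.
  have [i1 i2] : (i == j1) = false /\ (i == j2) = false by lia.
  case: (a =P 0) => a0; first by rewrite !inE !xpair_eqE eqxx i1 i2 /=; lia.
  case: (a =P 1) => a1; first by rewrite !inE !xpair_eqE eqxx /=; lia.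
  case: (a.+1 =P _) => al; first by rewrite !inE !xpair_eqE eqxx i1 i2 /=; lia.
  by case: (a.+2 =P _) => al2; rewrite !inE !xpair_eqE eqxx /=; lia.
have nji : (j == i) = false by apply/eqP.
rewrite -Ej {Ej}; have [Ej1|nj1] := eqVneq j j1; have [Ej2|nj2] := eqVneq j j2.
- by move: n12; rewrite -Ej1 Ej2 eqxx.
- rewrite -Ej1 in l1 *; do ?[case: ifP => ?];
  by rewrite !inE !xpair_eqE nji ?eqxx ?(negbTE nj2) /=; lia.
- rewrite -Ej2 in l2 *; do ?[case: ifP => ?];
  by rewrite !inE !xpair_eqE nji ?eqxx ?(negbTE nj1) /=; lia.
by do ?[case: ifP => _]; rewrite !inE !xpair_eqE nji ?(negbTE nj1) ?(negbTE nj2).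
Qed.

Lemma bnbrs_quartic m : 6 <= m -> regular_nbrs 4 (bverts m) (bnbrs m).
Proof.
move=> m6; split=> [|[i a]]; first exact: uniq_bverts.
rewrite mem_bverts => /andP[i3 ai]; have li := blen_gt5 i m6.
have sub : {subset bnbrs m (i, a) <= bverts m}.
  move=> [j b]; rewrite mem_bnbrs // mem_bverts; have := blen_gt5 j m6.
  by case: (j =P i) => [->|_]; lia.
split=> //.
- by rewrite /bnbrs; do 3?case: ifP.
- rewrite /bnbrs; have [n1 n2 n12] :
    [/\ i.+1 %% 3 != i, i.+2 %% 3 != i & i.+1 %% 3 != i.+2 %% 3] by split; lia.
  move: (i.+1 %% 3) (i.+2 %% 3) n1 n2 n12 => j k n1 n2 n12.
  do ?[case: ifP => ?];
    by rewrite /= !inE !xpair_eqE ?eqxx /= ?(eq_sym i)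
               ?(negbTE n1) ?(negbTE n2) ?(negbTE n12) /=; lia.
- by rewrite mem_bnbrs // eqxx /near eqxx /=; lia.
move=> [j b] jb; have := sub _ jb; rewrite mem_bverts => /andP[j3 bj].
move: jb; rewrite !mem_bnbrs //; have := blen_gt5 j m6.
case: (j =P i) bj => [->|ji] bj lj; first by rewrite eqxx /near; lia.
have -> : (i == j) = false by lia.
lia.
Qed.

(** * Hamilton paths of the quartic graphs *)

Lemma near_zigzag a :
  exists p, [/\ path near a p, perm_eq (a :: p) (iota 0 a.+1) & last a p = a.-1].
Proof.
elim: a => [|a [p [pp pa lp]]]; first by exists [::].
(* From [a.+1] jump to [a.-1], the end of the previous path, and run that path backwards. Unfolded,
   this goes down by twos and returns through the skipped numbers. *)
exists (rev (a :: p)); split; last by rewrite rev_cons last_rcons.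
  rewrite lastI rev_rcons /= lp; apply/andP; split; first by rewrite /near; lia.
  rewrite -lp rev_path; apply: sub_path pp => b d; by rewrite near_sym.
rewrite -[a.+2]addn1 iotaD perm_sym perm_catC perm_cons perm_sym.
by rewrite (perm_trans _ pa) // perm_rev.
Qed.

(** Everything up to [a] is used by the zigzag, which ends next to [a.+1]; from there the path
    climbs by ones. *)
Lemma near_up a n :
  exists p, [/\ path near a p, perm_eq (a :: p) (iota 0 (a + n).+2)
              & last a p = (a + n).+1].
Proof.
have step p b : path near a p -> perm_eq (a :: p) (iota 0 b.+1) ->
    near (last a p) b.+1 ->
    [/\ path near a (rcons p b.+1), perm_eq (a :: rcons p b.+1) (iota 0 b.+2)
      & last a (rcons p b.+1) = b.+1].
  move=> pp pb lp; rewrite rcons_path pp lp last_rcons; split=> //.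
  by rewrite -rcons_cons -cats1 -[b.+2]addn1 iotaD perm_cat.
elim: n => [|n [p [pp pn lp]]].
  rewrite addn0; have [p [pp pa lp]] := near_zigzag a.
  by exists (rcons p a.+1); apply: step; rewrite // lp /near; lia.
by exists (rcons p (a + n).+2); rewrite addnS; apply: step; rewrite // lp /near; lia.
Qed.

Lemma near_down b :
  exists p, [/\ path near b p, perm_eq (b :: p) (iota 0 b.+1) & last b p = 0].
Proof.
elim: b => [|b [p [pp pb lp]]]; first by exists [::].
exists (b :: p); split=> //; first by rewrite /= pp /near; lia.
by rewrite -[b.+2]addn1 iotaD perm_sym perm_catC perm_cons perm_sym.
Qed.

Lemma branch_path m i a p : 6 <= m -> i < 3 ->
    path near a p -> perm_eq (a :: p) (iota 0 (blen m i)) ->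
  path (grel (bnbrs m)) (i, a) (map (pair i) p).
Proof.
move=> m6 i3 pp pi; rewrite path_map.
apply: (sub_in_path (P := gtn (blen m i))) pp.
  by move=> b d bi di bd; rewrite /= mem_bnbrs // eqxx bd; apply/andP.
by apply/allP => b; rewrite (perm_mem pi) mem_iota.
Qed.

Lemma branch_up m i a : 6 <= m -> i < 3 -> a.+1 < blen m i ->
  exists p, [/\ path (grel (bnbrs m)) (i, a) p,
    perm_eq ((i, a) :: p) [seq (i, b) | b <- iota 0 (blen m i)]
    & last (i, a) p = (i, (blen m i).-1)].
Proof.
move=> m6 i3 ai; have [p [pp pa lp]] := near_up a (blen m i - a.+2).
have El : (a + (blen m i - a.+2)).+2 = blen m i by lia.
rewrite El in pa; exists (map (pair i) p); split; first exact: branch_path.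
  by rewrite -[_ :: _]/(map (pair i) (a :: p)) perm_map.
by rewrite last_map lp; congr (_, _); lia.
Qed.

Lemma branch_down m i : 6 <= m -> i < 3 ->
  exists p, [/\ path (grel (bnbrs m)) (i, (blen m i).-1) p,
    perm_eq ((i, (blen m i).-1) :: p) [seq (i, b) | b <- iota 0 (blen m i)]
    & last (i, (blen m i).-1) p = (i, 0)].
Proof.
move=> m6 i3; have [p [pp pb lp]] := near_down (blen m i).-1.
have li := blen_gt5 i m6; rewrite prednK in pb; last by lia.
exists (map (pair i) p); split; first exact: branch_path.
  by rewrite -[_ :: _]/(map (pair i) (_ :: p)) perm_map.
by rewrite last_map lp.
Qed.

Lemma branch_first m i j : 6 <= m -> i < 3 -> j < 3 -> i != j ->
  grel (bnbrs m) (i, 0) (j, 0).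
Proof.
move=> m6 i3 j3 ij; have li := blen_gt5 i m6; rewrite /= mem_bnbrs //; last by lia.
by rewrite eq_sym (negbTE ij) j3.
Qed.

Lemma branch_last m i j : 6 <= m -> i < 3 -> j < 3 -> i != j ->
  grel (bnbrs m) (i, (blen m i).-1) (j, (blen m j).-1).
Proof.
move=> m6 i3 j3 ij; have [li lj] := (blen_gt5 i m6, blen_gt5 j m6).
rewrite /= mem_bnbrs //; last by lia.
by rewrite eq_sym (negbTE ij) j3; lia.
Qed.

Lemma count_bverts m P : count P (bverts m) =
  count P [seq (0, b) | b <- iota 0 (blen m 0)] +
  (count P [seq (1, b) | b <- iota 0 (blen m 1)] +
   count P [seq (2, b) | b <- iota 0 (blen m 2)]).
Proof.
pose f i := [seq (i, b) | b <- iota 0 (blen m i)].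
by rewrite -[bverts m]/(f 0 ++ f 1 ++ f 2 ++ [::]) cats0 !count_cat.
Qed.

(** Up branch [i], across to the last vertex of the next branch, down it, across to the first vertex
    of the third, and up. *)
Lemma branch_hamilton m i a : 6 <= m -> i < 3 -> a.+1 < blen m i ->
  exists p, hamilton_seq (bverts m) (grel (bnbrs m)) (i, a) p /\
    last (i, a) p = (i.+2 %% 3, (blen m (i.+2 %% 3)).-1).
Proof.
move=> m6 i3 ai.
have [j3 k3] : i.+1 %% 3 < 3 /\ i.+2 %% 3 < 3 by lia.
have [nij njk] : i != i.+1 %% 3 /\ i.+1 %% 3 != i.+2 %% 3 by lia.
have [p [pp pi lp]] := branch_up m6 i3 ai.
have [q [qq qj lq]] := branch_down m6 j3.
have [|r [rr rk lr]] := @branch_up m _ 0 m6 k3;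
  first by have := blen_gt5 (i.+2 %% 3) m6; lia.
exists (p ++ (i.+1 %% 3, (blen m (i.+1 %% 3)).-1) :: q ++ (i.+2 %% 3, 0) :: r).
rewrite !(last_cat, last_cons) lr; split=> //; apply/andP; split.
  have := branch_last m6 i3 j3 nij; have := branch_first m6 j3 k3 njk.
  by rewrite /= cat_path pp lp /= cat_path qq lq /= rr => -> ->.
rewrite -cat_cons -cat_cons; apply/permP => P.
rewrite count_bverts !count_cat (permP pi) (permP qj) (permP rk).
case: i i3 {ai j3 k3 nij njk p pp pi lp q qq qj lq r rr rk lr} => [|[|[|i]]] // _.
  by rewrite addnA addnC.
by rewrite addnC addnA.
Qed.

Lemma bnbrs_traceable m : 6 <= m ->
  {in bverts m, forall v, exists x p,
     hamilton_seq (bverts m) (grel (bnbrs m)) x p /\ (v = x \/ v = last x p)}.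
Proof.
move=> m6 [i a]; rewrite mem_bverts => /andP[i3 ai].
have [ltai|geai] := ltnP a.+1 (blen m i).
  have [p [h _]] := branch_hamilton m6 i3 ltai.
  by exists (i, a), p; split; last left.
have j3 : i.+1 %% 3 < 3 by lia.
have [|p [h lp]] := @branch_hamilton m _ 0 m6 j3.
  by have := blen_gt5 (i.+1 %% 3) m6; lia.
(* The last vertex of branch [i] is the far end of the path that starts at the first vertex of the
   branch after it. *)
exists (i.+1 %% 3, 0), p; split; last right; rewrite // lp.
have -> : (i.+1 %% 3).+2 %% 3 = i by lia.
by congr (_, _); lia.
Qed.

(** * Longest cycles of the quartic graphs *)

Lemma bnbrs_long_cycle m : 6 <= m ->
  exists c, [/\ ucycle (grel (bnbrs m)) c, {subset c <= bverts m} & size c = m + 8].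
Proof.
move=> m6; have [|p [pp p2 lp]] := @branch_up m 2 0 m6 isT;
  first by rewrite /blen /=; lia.
have [q [qq q1 lq]] := @branch_down m 1 m6 isT.
(* Up branch 2, over the last vertex of branch 0, down branch 1, and back over the first vertex of
   branch 0, whose four interior vertices are missed. *)
pose c := ((2, 0) :: p) ++ [:: (0, 5)] ++ ((1, 5) :: q) ++ [:: (0, 0)].
have pc : perm_eq (c ++ [seq (0, a) | a <- iota 1 4]) (bverts m).
  apply/permP => P; rewrite count_bverts !count_cat (permP p2) (permP q1).
  have -> : count P [seq (0, b) | b <- iota 0 (blen m 0)] =
      count P [:: (0, 0)] +
      (count P [seq (0, b) | b <- iota 1 4] + count P [:: (0, 5)]).
    by rewrite -!count_cat.
  by do 5![move: (count P _) => ?]; lia.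
exists c; split.
- apply/andP; split; last first.
    by have := uniq_bverts m; rewrite -(perm_uniq pc) cat_uniq => /andP[].
  rewrite /c /= rcons_cat cat_path pp lp /= rcons_cat cat_path qq lq /= -/(grel _ _ _).
  have y20 : (0, 5) \in bnbrs m (2, m.-1) := @branch_last m 2 0 m6 isT isT isT.
  by rewrite y20.
- by move=> x xc; rewrite -(perm_mem pc) mem_cat xc.
by have := perm_size pc; rewrite size_cat size_bverts /=; lia.
Qed.

(* Otherwise Z, together with those of its two exits x and y that the cycle
   leaves towards Z, would be closed under the successor map of the cycle. *)
Lemma cycle_leaves (T : eqType) (c : seq T) (Z : pred T) x y z w :
    uniq c -> z \in c -> Z z -> w \in c -> ~~ [|| Z w, w == x | w == y] ->
    {in c, forall v, Z v -> [|| Z (next c v), next c v == x | next c v == y]} ->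
  [&& x \in c, Z (prev c x) & ~~ Z (next c x)] ||
  [&& y \in c, Z (prev c y) & ~~ Z (next c y)].
Proof.
move=> uc zc Zz wc nw Zc; apply: contraT => /norP[nx ny].
pose W v := [|| Z v, (v == x) && Z (next c x) | (v == y) && Z (next c y)].
have Wc : {in c, forall v, W v}.
  apply: (next_closed (x := z)) => //; first by rewrite /W Zz.
  move=> v vc /or3P[Zv|/andP[/eqP-> Zn]|/andP[/eqP-> Zn]]; rewrite /W ?Zn //.
  have nv : next c v \in c by rewrite mem_next.
  have pv : prev c (next c v) = v by rewrite prev_next.
  have /or3P[->//|/eqP Ev|/eqP Ev] := Zc _ vc Zv; rewrite {}Ev in nv pv *.
    by move: nx; rewrite nv pv Zv negbK eqxx => ->; rewrite orbT.
  by move: ny; rewrite nv pv Zv negbK eqxx => ->; rewrite !orbT.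
by move: nw (Wc _ wc); rewrite /W; case/norP=> /negbTE-> /norP[/negbTE-> /negbTE->].
Qed.

(** The cycle leaves [Z] through [x] or [y], and so does its reversal. One exit cannot serve both
    directions, since reversal swaps its two cycle neighbours; so [x] serves exactly one of them. *)
Lemma cycle_crosses (T : eqType) (c : seq T) (Z : pred T) x y z w :
    uniq c -> z \in c -> Z z -> w \in c -> ~~ [|| Z w, w == x | w == y] ->
    {in c, forall v, Z v -> [|| Z (next c v), next c v == x | next c v == y]} ->
    {in c, forall v, Z v -> [|| Z (prev c v), prev c v == x | prev c v == y]} ->
  x \in c /\ Z (next c x) = ~~ Z (prev c x).
Proof.
move=> uc zc Zz wc nw Zn Zp; have H1 := cycle_leaves uc zc Zz wc nw Zn.
have := @cycle_leaves _ (rev c) Z x y z w.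
rewrite rev_uniq !mem_rev !next_rev // !prev_rev //.
have Zr : {in rev c, forall v, Z v -> [|| Z (next (rev c) v), next (rev c) v == x
            | next (rev c) v == y]}.
  by move=> v; rewrite mem_rev next_rev //; apply: Zp.
move=> /(_ uc zc Zz wc nw Zr); move: H1.
by case: (x \in c); case: (y \in c); do 4!case: (Z _).
Qed.

Definition interior m i (v : nat * nat) := (v.1 == i) && (0 < v.2 < (blen m i).-1).

Lemma interior_nbrs m i u v : 6 <= m -> i < 3 -> interior m i u ->
  v \in bnbrs m u -> [|| interior m i v, v == (i, 0) | v == (i, (blen m i).-1)].
Proof.
move=> m6 i3; case: u v => [i' a] [j b] /andP[/= /eqP-> ai].
have li := blen_gt5 i m6; rewrite mem_bnbrs //; last by lia.
by rewrite /interior !xpair_eqE /=; case: (j =P i) => _ /=; lia.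
Qed.

Lemma first_nbrs m i v : 6 <= m -> i < 3 -> v \in bnbrs m (i, 0) ->
  interior m i v || [&& v.1 != i, v.1 < 3 & v.2 == 0].
Proof.
case: v => j b m6 i3; have li := blen_gt5 i m6; rewrite mem_bnbrs //; last by lia.
by rewrite /near /interior /=; case: eqP => _ /=; lia.
Qed.

(* A cycle meeting all three interiors enters or leaves the interior of branch i
   exactly once through (i, 0), so its other edge at (i, 0) joins (i, 0) to
   another first vertex: a perfect matching on three vertices. *)
Lemma bnbrs_cycle_misses m c : 6 <= m -> 2 < size c ->
    ucycle (grel (bnbrs m)) c -> {subset c <= bverts m} ->
  exists2 i, i < 3 & ~~ has (interior m i) c.
Proof.
move=> m6 c_gt2 /andP[gc uc] cs.
pose e i j := (next c (i, 0) == (j, 0)) || (next c (j, 0) == (i, 0)).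
have eC i j : e i j = e j i by rewrite /e orbC.
case: (boolP (has (interior m 0) c)) => h0; last by exists 0.
case: (boolP (has (interior m 1) c)) => h1; last by exists 1.
case: (boolP (has (interior m 2) c)) => h2; last by exists 2.
have hit i : i < 3 -> exists2 v, v \in c & interior m i v.
  by case: i => [|[|[|i]]] // _; apply/hasP.
have matched i j k : i < 3 -> j < 3 -> k < 3 -> i != j -> i != k -> j != k ->
    e i j = ~~ e i k.
  move=> i3 j3 k3 ij ik jk.
  (* The interior of branch [j] supplies a vertex of the cycle outside the interior of branch [i]
     and its two exits. *)
  have [z zc Zz] := hit i i3; have [w wc Zw] := hit j j3.
  have sym := regular_nbrs_sym (bnbrs_quartic m6).
  have prev_nbr v : v \in c -> prev c v \in bnbrs m v.
    move=> vc; have := prev_cycle gc vc.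
    by rewrite sym ?cs ?mem_prev.
  have next_nbr v : v \in c -> next c v \in bnbrs m v := next_cycle gc (x := v).
  have [|||xc Zx] :=
    @cycle_crosses _ c (interior m i) (i, 0) (i, (blen m i).-1) z w uc zc Zz wc.
  - case: w Zw {wc} => [j' b] /andP[/= /eqP-> _].
    by rewrite /interior !xpair_eqE /= eq_sym (negbTE ij).
  - by move=> v vc Zv; apply: (interior_nbrs m6 i3 Zv); apply: next_nbr.
  - by move=> v vc Zv; apply: (interior_nbrs m6 i3 Zv); apply: prev_nbr.
  have eE l : e i l = (next c (i, 0) == (l, 0)) || (prev c (i, 0) == (l, 0)).
    rewrite /e; congr (_ || _).
    by apply/eqP/eqP => [<-|<-]; rewrite ?prev_next ?next_prev.
  have first_nbr v : v \in bnbrs m (i, 0) ->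
      [|| interior m i v, v == (j, 0) | v == (k, 0)].
    case: v => l b /(first_nbrs m6 i3)/orP[-> //|/= /and3P[li l3 /eqP->]].
    rewrite !xpair_eqE !eqxx !andbT; apply/orP; right.
    by move: l3 i3 j3 k3 li ij ik jk; clear; lia.
  have notZ l : l != i -> interior m i (l, 0) = false
    by rewrite /interior => /negbTE /= ->.
  have nZj : interior m i (j, 0) = false by rewrite notZ // eq_sym.
  have nZk : interior m i (k, 0) = false by rewrite notZ // eq_sym.
  have kj : ((j, 0) == (k, 0) :> nat * nat) = false by rewrite xpair_eqE (negbTE jk).
  rewrite !eE; have := first_nbr _ (next_nbr _ xc); have := first_nbr _ (prev_nbr _ xc).
  move: Zx; case: (boolP (interior m i (prev c (i, 0)))) => Zp /= Zn; rewrite Zn /=.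
    have nZ l : l != i -> (prev c (i, 0) == (l, 0)) = false.
      by move=> li; apply: contraTF Zp => /eqP->; rewrite notZ.
    move=> _ /orP[] /eqP->; rewrite !nZ // 1?eq_sym // ?kj ?eqxx //.
    by rewrite eq_sym kj.
  have nZ l : l != i -> (next c (i, 0) == (l, 0)) = false.
    by move=> li; apply: contraTF Zn => /eqP->; rewrite notZ.
  move=> /orP[] /eqP-> _; rewrite !nZ // 1?eq_sym // ?kj ?eqxx //.
  by rewrite eq_sym kj.
(* The booleans [e 0 1], [e 0 2] and [e 1 2] would be pairwise different. *)
have := matched 0 1 2 isT isT isT isT isT isT.
have := matched 1 0 2 isT isT isT isT isT isT.
have := matched 2 0 1 isT isT isT isT isT isT.
by rewrite (eC 1 0) (eC 2 0) (eC 2 1); case: (e 0 1); case: (e 0 2); case: (e 1 2).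
Qed.

Lemma bnbrs_cycle_size m c : 6 <= m -> 2 < size c ->
    ucycle (grel (bnbrs m)) c -> {subset c <= bverts m} ->
  size c <= m + 8.
Proof.
move=> m6 c_gt2 gc cs; have [i i3 /hasPn Zc] := bnbrs_cycle_misses m6 c_gt2 gc cs.
have li := blen_gt5 i m6; case/andP: gc => _ uc.
(* Positions 1 to 4 are interior in every branch, as each has at least six vertices. *)
have : size (c ++ [seq (i, a) | a <- iota 1 4]) <= size (bverts m).
  apply: uniq_leq_size => [|v].
    rewrite cat_uniq uc map_inj_uniq ?iota_uniq ?andbT; last by move=> ? ? [].
    apply/hasPn => _ /mapP[a ai ->]; move: ai; rewrite mem_iota => ai.
    by apply/negP => /Zc; rewrite /interior /= eqxx /=; lia.
  rewrite mem_cat => /orP[/cs//|/mapP[a]]; rewrite mem_iota => ai ->.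
  by rewrite mem_bverts i3; lia.
by rewrite size_cat size_bverts /=; lia.
Qed.

Theorem theorem3 :
  (forall n : nat, ~~ odd n -> 10 <= n ->
     exists G : sgraph,
       [/\ graph_order G = n, regular 3 G,
           homogeneously_traceable G & nonhamiltonian G]) /\
  (forall p : nat, 18 <= p ->
     exists G : sgraph,
       [/\ graph_order G = p, regular 4 G,
           homogeneously_traceable G & has_circumference G (p - 4)]).
Proof.
split=> [n n_even n10 | p p18].
  pose k := (n - 10)./2.
  have nk : n = k.*2 + 10 by rewrite /k; lia.
  have [G [f [f_inj fs fe oG rG]]] := regular_nbrs_graph (pnbrs_cubic k).
  exists G; split=> //; first by rewrite oG size_pverts.
    apply: hamilton_seq_traceable f_inj fs fe _ (@pnbrs_traceable k).
    by have [] := pnbrs_cubic k.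
  case=> c [/(map_graph_cycle _ f_inj fe)[c_gt2 gc] c_all].
  apply: pnbrs_nonhamiltonian c_gt2 gc _ => x; rewrite -fs.
  apply/mapP/codomP => [[v _ ->]|[v ->]]; first by exists v.
  by exists v.
(* The two branches of length six take twelve vertices, so $p \ge 18$ leaves at least six for the
   third. *)
pose m := p - 12; have m6 : 6 <= m by rewrite /m; lia.
have [G [f [f_inj fs fe oG rG]]] := regular_nbrs_graph (bnbrs_quartic m6).
have -> : p - 4 = m + 8 by rewrite /m; lia.
exists G; split=> //; first by rewrite oG size_bverts /m; lia.
  exact: hamilton_seq_traceable f_inj fs fe (uniq_bverts m) (bnbrs_traceable m6).
split=> [|c /(map_graph_cycle _ f_inj fe)[c_gt2 gc]].
  have [c [gc cs size_c]] := bnbrs_long_cycle m6.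
  have [|q Eq] := @lift_seq _ _ f c; first by move=> x /cs; rewrite fs.
  exists q; rewrite (map_graph_cycle _ f_inj fe) -(size_map f) Eq size_c; split=> //.
  by split=> //; lia.
rewrite -(size_map f); apply: bnbrs_cycle_size => // x.
by case/mapP=> v _ ->; rewrite -fs codom_f.
Qed.
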